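(* Let $c\geq 1$ be a real number. The function $$x\mapsto Q_{1}(x)=\frac{\mathcal{K}(\sqrt{x})}{\ln\left(c/\sqrt{1-x}\right)}$$ is strictly concave on $(0,1)$ if and only if $c=e^{4/3}$.
   Context: For $r\in(0,1)$, $\mathcal{K}(r)=\int_{0}^{\pi/2}\frac{dt}{\sqrt{1-r^{2}\sin^{2}t}}$ is Legendre's complete elliptic integral of the first kind. *)

(* Defs.v *)
(* Stdlib reals with Coquelicot's Riemann integral. *)
From Stdlib Require Import Reals.
From Coquelicot Require Import Coquelicot.
Open Scope R_scope.

(* Coquelicot's [RInt] is total; the integrand is continuous for 0 < r < 1, the
   only range in which [ellK] is meaningful here. *)
Definition ellK (r : R) : R :=
  RInt (fun t => / sqrt (1 - r ^ 2 * (sin t) ^ 2)) 0 (PI / 2).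

Definition Q1 (c x : R) : R := ellK (sqrt x) / ln (c / sqrt (1 - x)).

Definition strictly_concave_on (a b : R) (f : R -> R) : Prop :=
  forall x y t : R, a < x < b -> a < y < b -> x <> y -> 0 < t < 1 ->
    t * f x + (1 - t) * f y < f (t * x + (1 - t) * y).

(* Main.v *)
(* Write y(x) = K(sqrt x), L(x) = l - ln (1 - x) / 2 with l = ln c, and Q = y / L.

   At 0, the second derivative of Q is a positive multiple of (3 l / 4 - 1)^2 (of
   its numerator, when l = 0), so concavity forces l = 4/3.

   Conversely let l = 4/3.  The hypergeometric equation for y becomes
     x (1 - x) L Q'' = W := Q (L - 2) / 4 - M Q',   M := x + (1 - 2 x) L
   ([scaled_derive2] and [drift] below),
   and differentiating it, using exp z > 1 + 9 z^2 / 8 for z = - ln (1 - x), gives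
   M W' < 0 wherever W >= 0.  The function M decreases from 4/3 to -oo.
   - Where M > 0, W >= 0 would propagate to the left and contradict W(0) = 0.
   - Where M = 0, L < 2, hence W < 0.
   - Where M < 0, W >= 0 would propagate to the right, so Q' would be bounded below
     near 1.  This is impossible since y - L tends to ln 4 - 4/3 > 0, so that
     Q - 1 is of order 1 / L. *)
Require Import Defs.
From Stdlib Require Import Reals Lra.
From Coquelicot Require Import Coquelicot.
Open Scope R_scope.

(** * The elliptic integral: derivatives in the parameter and hypergeometric equation *)

(** The parameter is the square of the modulus, so 0 is interior to the range [x < 1]. Each
    derivative in [x] raises [m] by one: for y(x) = K(sqrt x), y' is [/ 2 * ell_moment 1 x] and y''
    is [3 / 4 * ell_moment 2 x]. *)
Definition ell_integrand (m : nat) (x t : R) : R :=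
  (sin t ^ 2 / (1 - x * sin t ^ 2)) ^ m / sqrt (1 - x * sin t ^ 2).

Definition ell_moment (m : nat) (x : R) : R :=
  RInt (ell_integrand m x) 0 (PI / 2).

Lemma sin_sqr_bound (t : R) : 0 <= sin t ^ 2 <= 1.
Proof. pose proof (SIN_bound t); nra. Qed.

Lemma ell_radicand_pos (x t : R) : x < 1 -> 0 < 1 - x * sin t ^ 2.
Proof. intros Hx; pose proof (sin_sqr_bound t); destruct (Rle_dec x 0); nra. Qed.

Lemma is_derive_ell_integrand (m : nat) (x t : R) : x < 1 ->
  is_derive (fun u => ell_integrand m u t) x
    ((INR m + / 2) * ell_integrand (S m) x t).
Proof.
intros Hx.
pose proof (ell_radicand_pos x t Hx) as HD.
pose proof (sqrt_lt_R0 _ HD) as Hs.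
assert (Hss : sqrt (1 - x * sin t ^ 2) ^ 2 = 1 - x * sin t ^ 2)
  by (apply pow2_sqrt; lra).
unfold ell_integrand.
set (s := sin t ^ 2) in *.
assert (Hm : is_derive (fun u => (s / (1 - u * s)) ^ m) x
               (INR m * (s / (1 - x * s)) ^ S m)).
(* The power rule leaves the exponent [pred m]; at [m = 0] both sides vanish through the factor
   [INR 0]. *)
{ replace (INR m * (s / (1 - x * s)) ^ S m)
    with (INR m * (s * s / (1 - x * s) ^ 2) * (s / (1 - x * s)) ^ pred m).
  - apply (is_derive_pow (fun u => s / (1 - u * s))).
    auto_derive; [lra | field; lra].
  - destruct m as [|k]; [simpl; lra | cbn [pred pow]].
    generalize ((s / (1 - x * s)) ^ k); intros q; field; lra. }
assert (Hr : is_derive (fun u => / sqrt (1 - u * s)) x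
               (s / (1 - x * s) / sqrt (1 - x * s) / 2)).
{ auto_derive; [repeat split; try lra; apply Rgt_not_eq; apply Rlt_gt; exact Hs|].
  replace (1 + - (x * s)) with (1 - x * s) by ring.
  replace (s / (1 - x * s)) with (s / sqrt (1 - x * s) ^ 2) by now rewrite Hss.
  field; lra. }
evar_last.
- apply (is_derive_mult (fun u => (s / (1 - u * s)) ^ m)
           (fun u => / sqrt (1 - u * s)) x _ _ Hm Hr).
  intros; apply Rmult_comm.
- unfold mult, plus; simpl. field. lra.
Qed.

Lemma ell_integrand_continuity_2d (m : nat) (x t : R) : x < 1 ->
  continuity_2d_pt (ell_integrand m) x t.
Proof.
intros Hx.
pose proof (ell_radicand_pos x t Hx) as HD.
assert (Hsin : continuity_2d_pt (fun _ v => sin v ^ 2) x t).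
{ apply (continuity_1d_2d_pt_comp (fun v => sin v ^ 2) (fun _ v => v)).
  - apply continuity_pt_filterlim, (ex_derive_continuous (fun v => sin v ^ 2)).
    auto_derive; trivial.
  - apply continuity_2d_pt_id2. }
assert (Hrad : continuity_2d_pt (fun u v => 1 - u * sin v ^ 2) x t).
{ apply continuity_2d_pt_minus; [apply continuity_2d_pt_const|].
  apply continuity_2d_pt_mult; [apply continuity_2d_pt_id1 | exact Hsin]. }
unfold ell_integrand.
apply continuity_2d_pt_mult.
- apply (continuity_1d_2d_pt_comp (fun w => w ^ m)
           (fun u v => sin v ^ 2 / (1 - u * sin v ^ 2))).
  + apply continuity_pt_filterlim, (ex_derive_continuous (fun w => w ^ m)).
    auto_derive; trivial.
  + apply continuity_2d_pt_mult; [exact Hsin|].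
    apply continuity_2d_pt_inv; [exact Hrad | lra].
- apply continuity_2d_pt_inv.
  + apply continuity_1d_2d_pt_comp; [apply continuity_pt_sqrt; lra | exact Hrad].
  + apply Rgt_not_eq, sqrt_lt_R0; exact HD.
Qed.

Lemma ell_integrand_continuous (m : nat) (x t : R) : x < 1 ->
  continuous (ell_integrand m x) t.
Proof.
intros Hx.
apply continuity_pt_filterlim.
pose proof (ell_integrand_continuity_2d m x t Hx) as H.
intros e He. destruct (H (mkposreal e He)) as [d Hd].
exists d; split; [apply cond_pos|].
intros u [_ Hu]. apply Hd; [rewrite Rminus_diag, Rabs_R0; apply cond_pos | exact Hu].
Qed.

Lemma ex_RInt_ell_integrand (m : nat) (x a b : R) : x < 1 ->
  ex_RInt (ell_integrand m x) a b.
Proof.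
intros Hx; apply (ex_RInt_continuous (V := R_CompleteNormedModule)).
intros t _; apply ell_integrand_continuous; exact Hx.
Qed.

Lemma locally_lt (x b : R) : x < b -> locally x (fun u => u < b).
Proof. intros H; apply (open_lt b x H). Qed.

(** Differentiation under the integral sign, justified by the joint continuity of the differentiated
    integrand. *)
Lemma is_derive_ell_moment (m : nat) (x : R) : x < 1 ->
  is_derive (ell_moment m) x ((INR m + / 2) * ell_moment (S m) x).
Proof.
intros Hx.
assert (HD : forall u t, u < 1 -> Derive (fun z => ell_integrand m z t) u
               = (INR m + / 2) * ell_integrand (S m) u t).
{ intros u t Hu. apply is_derive_unique, is_derive_ell_integrand, Hu. }
unfold ell_moment at 2.
rewrite <- (RInt_scal (V := R_CompleteNormedModule))
  by (apply ex_RInt_ell_integrand; exact Hx).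
rewrite <- (RInt_ext (fun t => Derive (fun u => ell_integrand m u t) x)).
2:{ intros t _. rewrite HD by exact Hx. reflexivity. }
apply (is_derive_RInt_param (ell_integrand m)).
- apply filter_imp with (2 := locally_lt x 1 Hx).
  intros u Hu t _. eexists. apply is_derive_ell_integrand, Hu.
- intros t _.
  apply continuity_2d_pt_ext_loc
    with (fun u v => (INR m + / 2) * ell_integrand (S m) u v).
  + destruct (locally_lt x 1 Hx) as [d Hd].
    exists d. intros u v Hu _. symmetry; apply HD, Hd, Hu.
  + apply continuity_2d_pt_mult; [apply continuity_2d_pt_const|].
    apply ell_integrand_continuity_2d, Hx.
- apply filter_imp with (2 := locally_lt x 1 Hx).
  intros u Hu. apply ex_RInt_ell_integrand, Hu.
Qed.

Lemma ellK_sqrt (x : R) : 0 <= x -> ellK (sqrt x) = ell_moment 0 x.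
Proof.
intros Hx. apply RInt_ext; intros t _.
unfold ell_integrand. rewrite pow2_sqrt by exact Hx.
simpl. unfold Rdiv. ring.
Qed.

Lemma ell_moment_pos (m : nat) (x : R) : x < 1 -> 0 < ell_moment m x.
Proof.
intros Hx. pose proof PI_RGT_0.
apply RInt_gt_0; [lra | | intros; apply ell_integrand_continuous, Hx].
intros t Ht. pose proof (ell_radicand_pos x t Hx).
assert (0 < sin t) by (apply sin_gt_0; lra).
apply Rdiv_lt_0_compat; [|apply sqrt_lt_R0; assumption].
apply pow_lt, Rdiv_lt_0_compat; [apply pow_lt|]; assumption.
Qed.

(* The integrand of the left-hand side is the [t]-derivative of
   [- sin t * cos t / (4 * (1 - x * sin t ^ 2) ^ (3/2))]. *)
Lemma ell_moment_ode (x : R) : x < 1 ->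
  x * (1 - x) * (3 / 4 * ell_moment 2 x) + (1 - 2 * x) * (/ 2 * ell_moment 1 x)
  - / 4 * ell_moment 0 x = 0.
Proof.
intros Hx.
set (g t := x * (1 - x) * 3 / 4 * ell_integrand 2 x t
            + ((1 - 2 * x) / 2 * ell_integrand 1 x t
               + - / 4 * ell_integrand 0 x t)).
assert (HI : forall m k, is_RInt (fun t => k * ell_integrand m x t) 0 (PI / 2)
               (k * ell_moment m x)).
{ intros m k. apply (is_RInt_scal (V := R_NormedModule)).
  apply (RInt_correct (V := R_CompleteNormedModule)), ex_RInt_ell_integrand, Hx. }
assert (H1 : is_RInt g 0 (PI / 2)
  (x * (1 - x) * 3 / 4 * ell_moment 2 x
            + ((1 - 2 * x) / 2 * ell_moment 1 x
               + - / 4 * ell_moment 0 x))).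
{ apply (is_RInt_plus (V := R_NormedModule)); [apply HI|].
  apply (is_RInt_plus (V := R_NormedModule)); apply HI. }
set (G t := - / 4 * (sin t * cos t
              / ((1 - x * sin t ^ 2) * sqrt (1 - x * sin t ^ 2)))).
assert (H2 : is_RInt g 0 (PI / 2) (minus (G (PI / 2)) (G 0))).
{ apply (is_RInt_derive (V := R_CompleteNormedModule) G).
  - intros t _.
    pose proof (ell_radicand_pos x t Hx) as HD.
    pose proof (sqrt_lt_R0 _ HD) as Hs.
    assert (Hss : 1 - x * sin t ^ 2 = sqrt (1 - x * sin t ^ 2) ^ 2)
      by (symmetry; apply pow2_sqrt; lra).
    unfold G. auto_derive.
    + replace (1 + - (x * sin t ^ 2)) with (1 - x * sin t ^ 2) by ring.
      repeat split; try lra.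
      replace (1 + - (x * (sin t * (sin t * 1)))) with (1 - x * sin t ^ 2) by ring.
      apply Rmult_integral_contrapositive; split; lra.
    + unfold g, ell_integrand.
      replace (1 + - (x * (sin t * (sin t * 1)))) with (1 - x * sin t ^ 2) by ring.
      assert (Hc : cos t ^ 2 = 1 - sin t ^ 2)
        by (pose proof (sin2_cos2 t); unfold Rsqr in *; lra).
      set (r := sqrt (1 - x * sin t ^ 2)) in *.
      rewrite Hss.
      (* With [r ^ 2 = 1 - x * sin t ^ 2], everything is put over [r ^ 5]: first the derivative of
         [G] as it comes out, then a form in [sin t ^ 2] and [r ^ 2] whose three terms are those of
         [g]. *)
      transitivity (- / 4 * ((cos t ^ 2 - sin t ^ 2) * r ^ 2
                             + 3 * x * sin t ^ 2 * cos t ^ 2) / r ^ 5).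
      { field. lra. }
      transitivity ((3 / 4 * x * (1 - x) * (sin t ^ 2) ^ 2
                     + / 2 * (1 - 2 * x) * sin t ^ 2 * r ^ 2
                     - / 4 * (r ^ 2) ^ 2) / r ^ 5).
      { f_equal. rewrite Hc, <- Hss. field. }
      field. lra.
  - intros t _.
    repeat apply (continuous_plus (V := R_NormedModule));
      apply (continuous_scal_r (V := R_NormedModule)), ell_integrand_continuous, Hx. }
pose proof (is_RInt_unique _ _ _ _ H1) as E1.
rewrite (is_RInt_unique _ _ _ _ H2) in E1.
unfold minus, plus, opp, G in E1; simpl in E1.
rewrite cos_PI2, sin_0 in E1. lra.
Qed.

Lemma Derive_ell_moment (m : nat) (x : R) : x < 1 ->
  Derive (fun u => ell_moment m u) x = (INR m + / 2) * ell_moment (S m) x.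
Proof. intros Hx; apply is_derive_unique, is_derive_ell_moment, Hx. Qed.

(** * Values at 0 *)

Lemma ell_moment_0_at_0 : ell_moment 0 0 = PI / 2.
Proof.
unfold ell_moment.
rewrite (RInt_ext _ (fun _ => 1)).
- rewrite RInt_const. unfold scal; simpl; unfold mult; simpl. ring.
- intros t _. unfold ell_integrand. simpl.
  rewrite Rmult_0_l, Rminus_0_r, sqrt_1. field.
Qed.

(** The factor [x] kills the second-order term of the equation at 0, leaving y'(0) = y(0) / 4. *)
Lemma ell_moment_1_at_0 : ell_moment 1 0 = PI / 4.
Proof.
pose proof (ell_moment_ode 0 Rlt_0_1) as H. rewrite ell_moment_0_at_0 in H. lra.
Qed.

Lemma ell_moment_2_at_0 : ell_moment 2 0 = 3 * PI / 16.
Proof.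
pose proof (is_derive_ell_moment 0 0 Rlt_0_1) as H0.
pose proof (is_derive_ell_moment 1 0 Rlt_0_1) as H1.
pose proof (is_derive_ell_moment 2 0 Rlt_0_1) as H2.
(* Differentiating the differential equation at 0. *)
assert (H : is_derive (fun x => x * (1 - x) * (3 / 4 * ell_moment 2 x)
          + (1 - 2 * x) * (/ 2 * ell_moment 1 x) - / 4 * ell_moment 0 x) 0
          (3 / 2 * ell_moment 2 0 - 9 / 8 * ell_moment 1 0)).
{ auto_derive.
  - repeat split; eexists; eassumption.
  - rewrite !Derive_ell_moment by lra. simpl. field. }
assert (H' : is_derive (fun x => x * (1 - x) * (3 / 4 * ell_moment 2 x)
          + (1 - 2 * x) * (/ 2 * ell_moment 1 x) - / 4 * ell_moment 0 x) 0 0).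
{ apply (is_derive_ext_loc (fun _ => 0)).
  - apply filter_imp with (2 := locally_lt 0 1 Rlt_0_1).
    intros x Hx. symmetry. apply ell_moment_ode, Hx.
  - apply (is_derive_const (V := R_NormedModule)). }
apply is_derive_unique in H. apply is_derive_unique in H'.
rewrite H, ell_moment_1_at_0 in H'. lra.
Qed.

(** * The quotient and its first two derivatives *)

Definition log_denom (l x : R) : R := l - ln (1 - x) / 2.

Definition quot (l x : R) : R := ell_moment 0 x / log_denom l x.

Definition quot' (l x : R) : R :=
  (/ 2 * ell_moment 1 x * log_denom l x - ell_moment 0 x / (2 * (1 - x)))
  / log_denom l x ^ 2.

(** Kept apart from [quot''] because it stays continuous where [log_denom] vanishes, as happens at 0
    for [l = 0]. *)
Definition quot''_num (l x : R) : R :=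
  2 * (1 - x) ^ 2 * (3 / 4 * ell_moment 2 x) * log_denom l x ^ 2
  - (1 - x) * ell_moment 1 x * log_denom l x
  - ell_moment 0 x * (log_denom l x - 1).

Definition quot'' (l x : R) : R :=
  quot''_num l x / (2 * (1 - x) ^ 2 * log_denom l x ^ 3).

Lemma is_derive_log_denom (l x : R) : x < 1 ->
  is_derive (log_denom l) x (/ (2 * (1 - x))).
Proof. intros Hx; unfold log_denom; auto_derive; [lra | field; lra]. Qed.

Lemma Derive_log_denom (l x : R) : x < 1 ->
  Derive (fun u => log_denom l u) x = / (2 * (1 - x)).
Proof. intros Hx; apply is_derive_unique, is_derive_log_denom, Hx. Qed.

Lemma is_derive_quot (l x : R) : x < 1 -> 0 < log_denom l x ->
  is_derive (quot l) x (quot' l x).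
Proof.
intros Hx HL.
pose proof (is_derive_ell_moment 0 x Hx) as H0.
pose proof (is_derive_log_denom l x Hx) as H1.
unfold quot; auto_derive.
- repeat split; try (eexists; eassumption). lra.
- rewrite !Derive_ell_moment, !Derive_log_denom by lra.
  unfold quot'. simpl. field. lra.
Qed.

Lemma is_derive_quot' (l x : R) : x < 1 -> 0 < log_denom l x ->
  is_derive (quot' l) x (quot'' l x).
Proof.
intros Hx HL.
pose proof (is_derive_ell_moment 0 x Hx) as H0.
pose proof (is_derive_log_denom l x Hx) as H1.
pose proof (is_derive_ell_moment 1 x Hx) as H2.
unfold quot'; auto_derive.
- repeat split; try (eexists; eassumption); try lra.
  apply Rgt_not_eq; nra.
- rewrite !Derive_ell_moment, !Derive_log_denom by lra.
  unfold quot'', quot''_num. simpl INR. field. lra.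
Qed.

Lemma log_denom_increasing (l x y : R) : x < y -> y < 1 ->
  log_denom l x < log_denom l y.
Proof.
intros Hxy Hy. unfold log_denom.
assert (ln (1 - y) < ln (1 - x)) by (apply ln_increasing; lra). lra.
Qed.

Lemma log_denom_0 (l : R) : log_denom l 0 = l.
Proof. unfold log_denom. rewrite Rminus_0_r, ln_1. field. Qed.

Lemma ln_sqrt (u : R) : 0 < u -> ln (sqrt u) = ln u / 2.
Proof.
intros Hu. pose proof (sqrt_lt_R0 u Hu).
rewrite <- (sqrt_sqrt u) at 2 by lra. rewrite ln_mult by assumption. field.
Qed.

Lemma Q1_quot (c x : R) : 0 < c -> 0 <= x < 1 -> Q1 c x = quot (ln c) x.
Proof.
intros Hc Hx. unfold Q1, quot, log_denom.
assert (0 < sqrt (1 - x)) by (apply sqrt_lt_R0; lra).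
rewrite ellK_sqrt, ln_div by lra.
rewrite ln_sqrt by lra. reflexivity.
Qed.

(** * Strict concavity from a negative second derivative *)

Lemma decreasing_of_derive_neg (f f' : R -> R) (a b : R) : a < b ->
  (forall x, a <= x <= b -> is_derive f x (f' x)) ->
  (forall x, a < x < b -> f' x < 0) -> f b < f a.
Proof.
intros Hab Hf Hneg.
destruct (MVT_cor2 f f' a b Hab) as [c [E Hc]].
- intros c Hc. apply is_derive_Reals, Hf, Hc.
- specialize (Hneg c Hc). nra.
Qed.

Lemma strictly_concave_ext (a b : R) (f g : R -> R) :
  (forall x, a < x < b -> f x = g x) ->
  strictly_concave_on a b f -> strictly_concave_on a b g.
Proof.
intros E H x y t Hx Hy Hxy Ht.
rewrite <- !E by (try assumption; nra). apply H; assumption.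
Qed.

(** The mean value theorem on either side of the intermediate point gives slopes [f' c1 > f' c2];
    the concavity gap is their difference times [t * (1 - t) * (y - x)]. *)
Lemma strictly_concave_of_derive2_neg (a b : R) (f f' f'' : R -> R) :
  (forall x, a < x < b -> is_derive f x (f' x)) ->
  (forall x, a < x < b -> is_derive f' x (f'' x)) ->
  (forall x, a < x < b -> f'' x < 0) ->
  strictly_concave_on a b f.
Proof.
intros H1 H2 Hneg.
assert (Hdec : forall u v, a < u -> u < v -> v < b -> f' v < f' u).
{ intros u v Hu Huv Hv.
  apply decreasing_of_derive_neg with f''; [exact Huv | |];
    intros; [apply H2 | apply Hneg]; lra. }
assert (Hmvt : forall u v, a < u -> u < v -> v < b ->
  exists c, u < c < v /\ f v - f u = f' c * (v - u)).
{ intros u v Hu Huv Hv.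
  destruct (MVT_cor2 f f' u v Huv) as [c [E Hc]].
  - intros; apply is_derive_Reals, H1; lra.
  - exists c; split; assumption. }
assert (Hlt : forall x y t, a < x -> x < y -> y < b -> 0 < t < 1 ->
  t * f x + (1 - t) * f y < f (t * x + (1 - t) * y)).
{ intros x y t Hx Hxy Hy Ht.
  set (z := t * x + (1 - t) * y).
  assert (Hz : x < z < y) by (unfold z; nra).
  destruct (Hmvt x z) as [c1 [Hc1 E1]]; try lra.
  destruct (Hmvt z y) as [c2 [Hc2 E2]]; try lra.
  specialize (Hdec c1 c2 ltac:(lra) ltac:(lra) ltac:(lra)).
  assert (z - x = (1 - t) * (y - x)) by (unfold z; ring).
  assert (y - z = t * (y - x)) by (unfold z; ring).
  assert (E : f z - (t * f x + (1 - t) * f y)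
              = (f' c1 - f' c2) * (t * (1 - t) * (y - x))).
  { transitivity (t * (f z - f x) - (1 - t) * (f y - f z)); [ring|].
    rewrite E1, E2, H, H0. ring. }
  assert (0 < t * (1 - t) * (y - x)) by (repeat apply Rmult_lt_0_compat; lra).
  nra. }
intros x y t Hx Hy Hne Ht.
destruct (Rtotal_order x y) as [Hxy | [Hxy | Hxy]]; [|contradiction|].
- apply Hlt; lra.
- replace (t * x + (1 - t) * y) with ((1 - t) * y + (1 - (1 - t)) * x) by ring.
  replace (t * f x + (1 - t) * f y) with ((1 - t) * f y + (1 - (1 - t)) * f x) by ring.
  apply Hlt; lra.
Qed.

(** * Necessity of l = 4/3 *)

Lemma continuous_quot''_num (l x : R) : x < 1 -> continuous (quot''_num l) x.
Proof.
intros Hx. apply (ex_derive_continuous (V := R_NormedModule)).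
assert (HF : forall m, ex_derive (ell_moment m) x)
  by (intros m; eexists; apply is_derive_ell_moment, Hx).
assert (HL : ex_derive (log_denom l) x)
  by (eexists; apply is_derive_log_denom, Hx).
unfold quot''_num. auto_derive. auto 10.
Qed.

(** The numerator of Q'' is positive at 0, hence by continuity on some interval [(0, e)], where - Q
    is then strictly concave as well. *)
Lemma quot_not_concave (l : R) : 0 <= l -> l <> 4 / 3 ->
  ~ strictly_concave_on 0 1 (quot l).
Proof.
intros Hl Hne Hconc.
assert (H0 : 0 < quot''_num l 0).
{ replace (quot''_num l 0) with (PI / 2 * (3 / 4 * l - 1) ^ 2).
  - pose proof PI_RGT_0. apply Rmult_lt_0_compat; [lra|].
    apply pow2_gt_0; lra.
  - unfold quot''_num.
    rewrite log_denom_0, ell_moment_0_at_0, ell_moment_1_at_0, ell_moment_2_at_0.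
    field. }
destruct (continuous_quot''_num l 0 Rlt_0_1 _ (open_gt 0 _ H0)) as [d Hd].
set (e := Rmin d 1).
assert (He : 0 < e <= 1) by (unfold e; pose proof (cond_pos d); split;
  [apply Rmin_glb_lt; lra | apply Rmin_r]).
assert (Hed : e <= d) by apply Rmin_l.
assert (HL : forall x, 0 < x < 1 -> 0 < log_denom l x).
{ intros x Hx. pose proof (log_denom_increasing l 0 x). rewrite log_denom_0 in *. lra. }
assert (Hopp : strictly_concave_on 0 e (fun x => - quot l x)).
{ apply strictly_concave_of_derive2_neg
    with (fun x => - quot' l x) (fun x => - quot'' l x).
  - intros x Hx. apply (is_derive_opp (V := R_NormedModule)), is_derive_quot;
      [lra | apply HL; lra].
  - intros x Hx. apply (is_derive_opp (V := R_NormedModule)), is_derive_quot';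
      [lra | apply HL; lra].
  - intros x Hx. apply Ropp_lt_gt_0_contravar.
    assert (0 < log_denom l x) by (apply HL; lra).
    apply Rdiv_lt_0_compat.
    + apply Hd. unfold ball; simpl; unfold AbsRing_ball, abs, minus, plus, opp; simpl.
      rewrite Ropp_0, Rplus_0_r, Rabs_right; lra.
    + repeat apply Rmult_lt_0_compat; try apply pow_lt; lra. }
(* Any two points of [(0, e)] do: the strict midpoint inequalities for Q and - Q contradict each
   other. *)
specialize (Hconc (e / 3) (e / 2) (/ 2) ltac:(lra) ltac:(lra) ltac:(lra) ltac:(lra)).
specialize (Hopp (e / 3) (e / 2) (/ 2) ltac:(lra) ltac:(lra) ltac:(lra) ltac:(lra)).
simpl in Hopp. lra.
Qed.

(** * Logarithmic bounds on the elliptic integral near 1 *)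

Lemma sin_cos_bounds (t : R) : 0 <= t <= PI / 2 ->
  0 <= sin t <= 1 /\ 0 <= cos t <= 1 /\ cos t ^ 2 = 1 - sin t ^ 2.
Proof.
intros Ht.
pose proof (sin_ge_0 t ltac:(lra) ltac:(lra)).
pose proof (cos_ge_0 t ltac:(lra) ltac:(lra)).
pose proof (SIN_bound t). pose proof (COS_bound t).
pose proof (sin2_cos2 t). unfold Rsqr in *. repeat split; lra.
Qed.

(** At [u = 1 - x] this integral carries the logarithmic singularity of the elliptic integral at
    1. *)
Lemma is_RInt_sin_over_sqrt (u : R) : 0 < u ->
  is_RInt (fun t => sin t / sqrt (cos t ^ 2 + u)) 0 (PI / 2)
    (ln (1 + sqrt (1 + u)) - ln u / 2).
Proof.
intros Hu. pose proof PI_RGT_0.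
set (G t := - ln (cos t + sqrt (cos t ^ 2 + u))).
replace (ln (1 + sqrt (1 + u)) - ln u / 2) with (minus (G (PI / 2)) (G 0)).
2:{ unfold G, minus, plus, opp; simpl. rewrite cos_PI2, cos_0.
    replace (0 * (0 * 1) + u) with u by ring.
    replace (1 * (1 * 1) + u) with (1 + u) by ring.
    rewrite Rplus_0_l, ln_sqrt by exact Hu. lra. }
apply (is_RInt_derive (V := R_CompleteNormedModule) G);
  rewrite Rmin_left, Rmax_right by lra; intros t Ht;
  destruct (sin_cos_bounds t Ht) as [Hs [Hc _]];
  assert (Hr : 0 < cos t ^ 2 + u) by nra;
  pose proof (sqrt_lt_R0 _ Hr) as Hr'.
- unfold G. auto_derive;
    replace (cos t * (cos t * 1) + u) with (cos t ^ 2 + u) by ring.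
  + repeat split; lra.
  + field. split; lra.
- apply (ex_derive_continuous (V := R_NormedModule)). auto_derive.
  replace (cos t * (cos t * 1) + u) with (cos t ^ 2 + u) by ring.
  repeat split; lra.
Qed.

Lemma Rdiv_le_compat_denom (a b c : R) : 0 <= a -> 0 < b -> b <= c -> a / c <= a / b.
Proof.
intros Ha Hb Hbc. apply Rmult_le_compat_l; [exact Ha|].
apply Rinv_le_contravar; assumption.
Qed.

(** The numerator 1 is split as [sin t + (1 - sin t)]. The first part is compared with the explicit
    integral above; the second, by [r <= cos t + v], with [cos t / (1 + sin t) - v], which supplies
    the other [ln 2]. *)
Lemma ell_moment_lower (x : R) : 0 <= x < 1 ->
  2 * ln 2 - ln (1 - x) / 2 - PI / 2 * sqrt (1 - x) <= ell_moment 0 x.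
Proof.
intros Hx. pose proof PI_RGT_0.
set (u := 1 - x).
assert (Hu : 0 < u) by (unfold u; lra).
pose proof (sqrt_lt_R0 _ Hu) as Hv. pose proof (pow2_sqrt u ltac:(lra)) as Hv2.
set (v := sqrt u) in *.
assert (HI : is_RInt (fun t => sin t / sqrt (cos t ^ 2 + u) + (cos t / (1 + sin t) - v))
          0 (PI / 2) (ln (1 + sqrt (1 + u)) - ln u / 2 + (ln 2 - v * (PI / 2)))).
{ apply (is_RInt_plus (V := R_NormedModule)); [apply is_RInt_sin_over_sqrt, Hu|].
  set (G t := ln (1 + sin t) - v * t).
  replace (ln 2 - v * (PI / 2)) with (minus (G (PI / 2)) (G 0)).
  2:{ unfold G, minus, plus, opp; simpl. rewrite sin_PI2, sin_0.
      rewrite Rplus_0_r, ln_1. replace (1 + 1) with 2 by ring. ring. }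
  apply (is_RInt_derive (V := R_CompleteNormedModule) G);
    rewrite Rmin_left, Rmax_right by lra; intros t Ht;
    destruct (sin_cos_bounds t Ht) as [Hs [Hc _]].
  - unfold G. auto_derive; [lra | field; lra].
  - apply (ex_derive_continuous (V := R_NormedModule)). auto_derive. lra. }
assert (Hln : ln 2 <= ln (1 + sqrt (1 + u))).
{ apply ln_le; [lra|]. pose proof (sqrt_le_1_alt 1 (1 + u)). rewrite sqrt_1 in *. lra. }
apply Rle_trans with (ln (1 + sqrt (1 + u)) - ln u / 2 + (ln 2 - v * (PI / 2))); [lra|].
rewrite <- (is_RInt_unique _ _ _ _ HI).
apply RInt_le; [lra | eexists; exact HI | apply ex_RInt_ell_integrand; lra |].
intros t Ht. destruct (sin_cos_bounds t ltac:(lra)) as [Hs [Hc Hsc]].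
unfold ell_integrand.
pose proof (ell_radicand_pos x t ltac:(lra)) as HD.
pose proof (sqrt_lt_R0 _ HD) as Hr. pose proof (pow2_sqrt _ (Rlt_le _ _ HD)) as Hr2.
set (r := sqrt (1 - x * sin t ^ 2)) in *.
assert (Hra : r <= sqrt (cos t ^ 2 + u)) by (apply sqrt_le_1_alt; unfold u; nra).
assert (Hrv : r <= cos t + v) by (apply Rsqr_incr_0_var; unfold Rsqr; unfold u in *; nra).
apply Rle_trans with (sin t / r + (1 - sin t) / r); [|right; simpl; field; lra].
apply Rplus_le_compat; [apply Rdiv_le_compat_denom; lra|].
apply Rle_trans with ((1 - sin t) / (cos t + v));
  [|apply Rdiv_le_compat_denom; lra].
apply Rmult_le_reg_r with ((1 + sin t) * (cos t + v)); [nra|].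
replace ((1 - sin t) / (cos t + v) * ((1 + sin t) * (cos t + v)))
  with (1 - sin t ^ 2) by (field; lra).
replace ((cos t / (1 + sin t) - v) * ((1 + sin t) * (cos t + v)))
  with ((cos t - v * (1 + sin t)) * (cos t + v)) by (field; lra).
rewrite <- Hsc.
(* The two sides differ by this product plus [v ^ 2]. *)
assert (0 <= sin t * v * (cos t + v)) by (repeat apply Rmult_le_pos; lra).
nra.
Qed.

(** The same splitting, now with lower bounds on the root: [x * a <= r] for the first part and
    [1 - sin t <= r] for the second. *)
Lemma ell_moment_upper (x : R) : / 2 <= x < 1 ->
  ell_moment 0 x <= 7 - ln (1 - x) / 2.
Proof.
intros Hx. pose proof PI_RGT_0. pose proof PI_4.
set (u := 1 - x).
assert (Hu : 0 < u) by (unfold u; lra).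
pose proof (is_RInt_sin_over_sqrt u Hu) as HJ.
set (J := ln (1 + sqrt (1 + u)) - ln u / 2) in *.
assert (HI : is_RInt (fun t => / x * (sin t / sqrt (cos t ^ 2 + u)) + 1)
          0 (PI / 2) (/ x * J + PI / 2)).
{ apply (is_RInt_plus (V := R_NormedModule)).
  - apply (is_RInt_scal (V := R_NormedModule)); exact HJ.
  - replace (PI / 2) with (scal (PI / 2 - 0) 1) at 2
      by (unfold scal; simpl; unfold mult; simpl; ring).
    apply (is_RInt_const (V := R_NormedModule)). }
apply Rle_trans with (/ x * J + PI / 2).
{ rewrite <- (is_RInt_unique _ _ _ _ HI).
  apply RInt_le; [lra | apply ex_RInt_ell_integrand; lra | eexists; exact HI |].
  intros t Ht. destruct (sin_cos_bounds t ltac:(lra)) as [Hs [Hc Hsc]].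
  unfold ell_integrand.
  pose proof (ell_radicand_pos x t ltac:(lra)) as HD.
  pose proof (sqrt_lt_R0 _ HD) as Hr. pose proof (pow2_sqrt _ (Rlt_le _ _ HD)) as Hr2.
  set (r := sqrt (1 - x * sin t ^ 2)) in *.
  assert (Ha0 : 0 < cos t ^ 2 + u) by nra.
  pose proof (sqrt_lt_R0 _ Ha0) as Ha. pose proof (pow2_sqrt _ (Rlt_le _ _ Ha0)) as Ha2.
  set (a := sqrt (cos t ^ 2 + u)) in *.
  assert (Har : x * a <= r).
  { apply Rsqr_incr_0_var; [|lra]. unfold Rsqr.
    replace (r * r) with (1 - x * sin t ^ 2) by nra.
    replace (x * a * (x * a)) with (x * (x * a ^ 2)) by ring.
    rewrite Ha2, Hsc. unfold u.
    assert (x * (1 - sin t ^ 2 + (1 - x)) <= 1 - x * sin t ^ 2) by nra.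
    assert (0 <= x * (1 - sin t ^ 2 + (1 - x))) by (apply Rmult_le_pos; nra).
    nra. }
  assert (Hrs : 1 - sin t <= r).
  { apply Rsqr_incr_0_var; [|lra]. unfold Rsqr. nra. }
  apply Rle_trans with (sin t / r + (1 - sin t) / r); [right; simpl; field; lra|].
  apply Rplus_le_compat.
  - replace (/ x * (sin t / a)) with (sin t / (x * a)) by (field; lra).
    apply Rdiv_le_compat_denom; nra.
  - apply Rmult_le_reg_r with r; [exact Hr|].
    unfold Rdiv. rewrite Rmult_assoc, Rinv_l; lra. }
assert (HJ2 : J <= 2 - ln u / 2).
{ unfold J.
  assert (sqrt (1 + u) <= 2) by (apply Rsqr_incr_0_var; [rewrite Rsqr_sqrt; unfold Rsqr; unfold u in *; lra | lra]).
  pose proof (exp_ineq1_le (sqrt (1 + u))) as He.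
  pose proof (sqrt_pos (1 + u)).
  apply ln_le in He; [|lra]. rewrite ln_exp in He. lra. }
assert (Hxi : / x <= 1 + 2 * u).
{ apply Rmult_le_reg_r with x; [lra|]. rewrite Rinv_l by lra. unfold u. nra. }
(* [- u ln u <= 1 - u] since [ln (1 / u) <= 1 / u - 1]. *)
assert (Huln : - (u * ln u) <= 1).
{ pose proof (exp_ineq1_le (- ln u)) as He.
  rewrite exp_Ropp, exp_ln in He by exact Hu.
  apply Rmult_le_compat_l with (r := u) in He; [|lra].
  rewrite Rinv_r in He by lra. lra. }
assert (Hlnu : ln u <= 0).
{ rewrite <- ln_1. apply ln_le; unfold u in *; lra. }
assert (HJ3 : / x * J <= (1 + 2 * u) * (2 - ln u / 2)).
{ assert (0 < / x) by (apply Rinv_0_lt_compat; lra).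
  apply Rle_trans with (/ x * (2 - ln u / 2)).
  - apply Rmult_le_compat_l; lra.
  - apply Rmult_le_compat_r; lra. }
(* The 7 collects 2, [4 * u <= 2], [- (u * ln u) <= 1] and [PI / 2 <= 2]. *)
assert (u <= / 2) by (unfold u; lra).
lra.
Qed.

(** * Two numerical inequalities *)

(** Since [(23 / 24) ^ 16 > / 2] and [ln (23 / 24) <= - (1 / 24)]. This makes the limit ln 4 - 4/3
    of y - L positive. *)
Lemma two_thirds_lt_ln_2 : 2 / 3 < ln 2.
Proof.
pose proof (exp_ineq1_le (- (1 / 24))) as He.
apply ln_le in He; [|lra]. rewrite ln_exp in He.
assert (H : ln (/ 2) < ln ((1 + - (1 / 24)) ^ 16)) by (apply ln_increasing; lra).
rewrite ln_pow, ln_Rinv in H by lra. simpl in H. lra.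
Qed.

Lemma exp_gt_quadratic (z : R) : 0 < z -> 1 + 9 / 8 * z ^ 2 < exp z.
Proof.
intros Hz. pose proof (exp_ge_taylor z 3 ltac:(lra)) as H. simpl in H.
apply Rlt_le_trans with (1 + z + z ^ 2 / 2 + z ^ 3 / 6); [|lra].
assert (0 < z * (1 - 5 / 8 * z + z ^ 2 / 6)).
(* The quadratic has its minimum at [15 / 8], where it is positive. *)
{ apply Rmult_lt_0_compat; [exact Hz|]. pose proof (pow2_ge_0 (z - 15 / 8)). nra. }
nra.
Qed.

(** * The differential equation of the quotient at l = 4/3 *)

Local Notation L := (log_denom (4 / 3)).

Definition drift (x : R) : R := x + (1 - 2 * x) * L x.

Definition scaled_derive2 (x : R) : R :=
  quot (4 / 3) x * (L x - 2) / 4 - drift x * quot' (4 / 3) x.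

(** The coefficient of Q' is [(L x - 2) / 4] minus the derivative of [drift]. *)
Definition scaled_derive2' (x : R) : R :=
  quot (4 / 3) x / (8 * (1 - x))
  + (9 / 4 * L x + / (2 * (1 - x)) - 5 / 2) * quot' (4 / 3) x
  - drift x * quot'' (4 / 3) x.

Lemma log_denom_ge (x : R) : 0 <= x < 1 -> 4 / 3 <= L x.
Proof.
intros Hx. rewrite <- (log_denom_0 (4 / 3)) at 1.
destruct (Req_dec x 0) as [-> | Hne]; [lra|].
left; apply log_denom_increasing; lra.
Qed.

(** This is the hypergeometric equation for y = Q L; the terms in Q coming from L' and L'' add up to
    Q / 2. *)
Lemma quot_ode (x : R) : 0 <= x < 1 ->
  x * (1 - x) * L x * quot'' (4 / 3) x = scaled_derive2 x.
Proof.
intros Hx. pose proof (log_denom_ge x Hx).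
pose proof (ell_moment_ode x ltac:(lra)) as H0.
assert (E : ell_moment 0 x
  = 4 * (x * (1 - x) * (3 / 4 * ell_moment 2 x)
         + (1 - 2 * x) * (/ 2 * ell_moment 1 x))) by lra.
unfold scaled_derive2, drift, quot, quot', quot'', quot''_num. rewrite E. field. lra.
Qed.

Lemma is_derive_drift (x : R) : x < 1 ->
  is_derive drift x (2 - 2 * L x - / (2 * (1 - x))).
Proof.
intros Hx. unfold drift. auto_derive.
- eexists; apply is_derive_log_denom, Hx.
- rewrite Derive_log_denom by exact Hx. field. lra.
Qed.

Lemma is_derive_scaled_derive2 (x : R) : 0 <= x < 1 -> is_derive scaled_derive2 x (scaled_derive2' x).
Proof.
intros Hx. pose proof (log_denom_ge x Hx).
pose proof (is_derive_quot (4 / 3) x ltac:(lra) ltac:(lra)) as H1.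
pose proof (is_derive_quot' (4 / 3) x ltac:(lra) ltac:(lra)) as H2.
pose proof (is_derive_drift x ltac:(lra)) as H3.
pose proof (is_derive_log_denom (4 / 3) x ltac:(lra)) as H4.
unfold scaled_derive2. auto_derive.
- repeat split; eexists; eassumption.
- replace (Derive (fun u => quot (4 / 3) u) x) with (quot' (4 / 3) x)
    by (symmetry; apply is_derive_unique, H1).
  replace (Derive (fun u => quot' (4 / 3) u) x) with (quot'' (4 / 3) x)
    by (symmetry; apply is_derive_unique, H2).
  replace (Derive (fun u => drift u) x) with (2 - 2 * L x - / (2 * (1 - x)))
    by (symmetry; apply is_derive_unique, H3).
  rewrite Derive_log_denom by lra. unfold scaled_derive2'. field. lra.
Qed.

Lemma quot_pos (x : R) : 0 <= x < 1 -> 0 < quot (4 / 3) x.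
Proof.
intros Hx. pose proof (log_denom_ge x Hx).
apply Rdiv_lt_0_compat; [apply ell_moment_pos|]; lra.
Qed.

(** Eliminating M Q' through W turns M W' into Q times the expression in [Hkey], minus B W, minus
    M^2 Q''. The last two subtracted terms are nonnegative when W is. *)
Lemma scaled_derive2_derive_sign (x : R) : 0 < x < 1 -> 0 <= scaled_derive2 x -> drift x * scaled_derive2' x < 0.
Proof.
intros Hx HW.
pose proof (log_denom_ge x ltac:(lra)) as HL.
pose proof (quot_pos x ltac:(lra)) as HQ.
pose proof (quot_ode x ltac:(lra)) as Hode.
set (B := 9 / 4 * L x + / (2 * (1 - x)) - 5 / 2).
assert (HB : 0 < B).
{ assert (0 < / (2 * (1 - x))) by (apply Rinv_0_lt_compat; lra). unfold B; lra. }
assert (HQ2 : 0 <= quot'' (4 / 3) x).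
{ apply Rmult_le_reg_l with (x * (1 - x) * L x); [|lra].
  repeat apply Rmult_lt_0_compat; lra. }
assert (Hkey : B * (L x - 2) / 4 + drift x / (8 * (1 - x)) < 0).
{ assert (Hz : 0 < - ln (1 - x)).
  { rewrite <- Ropp_0, <- ln_1. apply Ropp_lt_contravar, ln_increasing; lra. }
  pose proof (exp_gt_quadratic _ Hz) as He.
  rewrite exp_Ropp, exp_ln in He by lra.
  apply Rmult_lt_compat_l with (r := 1 - x) in He; [|lra].
  rewrite Rinv_r in He by lra.
  (* With z = - ln (1 - x), the terms linear in z cancel, and the quadratic bound on exp z makes the
     numerator negative. *)
  replace (B * (L x - 2) / 4 + drift x / (8 * (1 - x)))
    with (((1 - x) * (1 + 9 / 8 * (- ln (1 - x)) ^ 2) - 1) / (8 * (1 - x))).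
  - apply Rdiv_neg_pos; lra.
  - unfold B, drift, log_denom. field. lra. }
assert (HMQ : drift x * quot' (4 / 3) x = quot (4 / 3) x * (L x - 2) / 4 - scaled_derive2 x)
  by (unfold scaled_derive2; ring).
replace (drift x * scaled_derive2' x) with
  (quot (4 / 3) x * (drift x / (8 * (1 - x)))
   + B * (drift x * quot' (4 / 3) x)
   - drift x ^ 2 * quot'' (4 / 3) x) by (unfold scaled_derive2', B; field; lra).
rewrite HMQ.
assert (0 <= drift x ^ 2 * quot'' (4 / 3) x)
  by (apply Rmult_le_pos; [apply pow2_ge_0 | exact HQ2]).
assert (0 <= B * scaled_derive2 x) by (apply Rmult_le_pos; lra).
nra.
Qed.

(** * Negativity of W according to the sign of M *)

Lemma drift_decreasing (x y : R) : 0 <= x -> x < y -> y < 1 -> drift y < drift x.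
Proof.
intros Hx Hxy Hy.
apply decreasing_of_derive_neg with (fun z => 2 - 2 * L z - / (2 * (1 - z)));
  [exact Hxy | intros; apply is_derive_drift; lra |].
intros z Hz. pose proof (log_denom_ge z ltac:(lra)).
assert (0 < / (2 * (1 - z))) by (apply Rinv_0_lt_compat; lra). lra.
Qed.

(* The maximum of [f] cannot be attained at a point other than [b]. *)
Lemma nonneg_at_right_end (f f' : R -> R) (a b : R) : a <= b ->
  (forall x, a <= x <= b -> is_derive f x (f' x)) ->
  (forall x, a <= x < b -> 0 <= f x -> 0 < f' x) ->
  0 <= f a -> f a <= f b.
Proof.
intros Hab Hf Hpos Ha.
destruct (continuity_ab_maj f a b Hab) as [m [Hm Hmab]].
{ intros c Hc. apply continuity_pt_filterlim,
    (ex_derive_continuous (V := R_NormedModule)).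
  eexists; apply Hf, Hc. }
assert (Hfa : f a <= f m) by (apply Hm; lra).
destruct (Rle_lt_or_eq_dec m b (proj2 Hmab)) as [Hlt | ->]; [exfalso | exact Hfa].
specialize (Hpos m ltac:(lra) ltac:(lra)).
pose proof (proj1 (is_derive_Reals f m (f' m)) (Hf m Hmab)) as Hd.
(* The tolerance [f' m] makes nearby difference quotients positive, so a step to the right of [m]
   exceeds the maximum. *)
destruct (Hd (f' m) Hpos) as [d Hd'].
pose proof (cond_pos d) as Hdp.
set (h := Rmin (d / 2) (b - m)).
assert (Hh : 0 < h) by (apply Rmin_glb_lt; lra).
assert (h <= d / 2) by apply Rmin_l. assert (h <= b - m) by apply Rmin_r.
specialize (Hd' h ltac:(lra)). rewrite (Rabs_right h) in Hd' by lra.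
specialize (Hd' ltac:(lra)). apply Rabs_def2 in Hd'.
assert (Hq : 0 < (f (m + h) - f m) / h) by lra.
apply Rmult_lt_compat_r with (r := h) in Hq; [|exact Hh].
unfold Rdiv in Hq. rewrite Rmult_assoc, Rinv_l in Hq by lra.
specialize (Hm (m + h) ltac:(lra)). lra.
Qed.

Lemma scaled_derive2_0 : scaled_derive2 0 = 0.
Proof. rewrite <- quot_ode by lra. ring. Qed.

Lemma scaled_derive2_neg_of_drift_pos (x : R) : 0 < x < 1 -> 0 < drift x -> scaled_derive2 x < 0.
Proof.
intros Hx HM. apply Rnot_le_lt; intros HW.
assert (HM' : forall y, 0 <= y <= x -> 0 < drift y).
{ intros y Hy. destruct (Req_dec y x) as [-> | Hne]; [exact HM|].
  pose proof (drift_decreasing y x); lra. }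
assert (Hsign : forall y, 0 < y <= x -> 0 <= scaled_derive2 y -> scaled_derive2' y < 0).
{ intros y Hy Hwy. pose proof (scaled_derive2_derive_sign y ltac:(lra) Hwy).
  pose proof (HM' y ltac:(lra)). nra. }
assert (Hpos : forall y, 0 < y <= x -> 0 <= scaled_derive2 y).
{ intros y Hy.
  apply Rle_trans with (1 := HW).
  (* The reflection s -> - s turns propagation to the left into propagation to the right. *)
  pose proof (nonneg_at_right_end (fun s => scaled_derive2 (- s)) (fun s => - scaled_derive2' (- s)) (- x) (- y)
    ltac:(lra)) as H.
  cbv beta in H. rewrite !Ropp_involutive in H.
  apply H; [| |exact HW].
  - intros s Hs.
    pose proof (is_derive_scaled_derive2 (- s) ltac:(lra)) as Hd.
    evar_last.
    + apply (is_derive_comp scaled_derive2 (fun s => - s)); [exact Hd|].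
      auto_derive; [trivial | reflexivity].
    + unfold scal; simpl; unfold mult; simpl. ring.
  - intros s Hs Hws. pose proof (Hsign (- s) ltac:(lra) Hws). lra. }
pose proof (decreasing_of_derive_neg scaled_derive2 scaled_derive2' 0 x ltac:(lra)
  ltac:(intros; apply is_derive_scaled_derive2; lra)
  ltac:(intros y Hy; apply Hsign; [lra | apply Hpos; lra])) as H.
rewrite scaled_derive2_0 in H. lra.
Qed.

Lemma scaled_derive2_neg_of_drift_0 (x : R) : 0 < x < 1 -> drift x = 0 -> scaled_derive2 x < 0.
Proof.
intros Hx HM. unfold scaled_derive2. rewrite HM.
pose proof (quot_pos x ltac:(lra)).
assert (HL : L x < 2); [|nra].
apply Rnot_le_lt; intros HL.
(* [2 <= L x] means [exp (4/3) <= 1 / (1 - x)], while [3 < exp (4/3)]. *)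
assert (Hx2 : 2 / 3 < x).
{ apply Rnot_le_lt; intros Hx2. unfold log_denom in HL.
  pose proof (exp_ge_taylor (4 / 3) 2 ltac:(lra)) as He. simpl in He.
  assert (H3 : ln 3 < ln (exp (4 / 3))) by (apply ln_increasing; lra).
  rewrite ln_exp in H3.
  assert (Hln : ln (/ 3) <= ln (1 - x)) by (apply ln_le; lra).
  rewrite ln_Rinv in Hln by lra. lra. }
(* With [2 <= L x] and [2 / 3 < x], [drift x] is at most [2 - 3 * x], which is negative. *)
unfold drift in HM. nra.
Qed.

(* Near 1 the quotient exceeds its limit 1 by a multiple of [1 / L], which a
   function of bounded slope cannot do. *)
Lemma quot_not_lipschitz_at_1 (C a : R) : 0 <= C -> 0 <= a < 1 ->
  ~ (forall x b, a <= x -> x < b -> b < 1 ->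
       quot (4 / 3) x <= quot (4 / 3) b + C * (1 - x)).
Proof.
intros HC Ha HQ.
(* Half of the limit of y - L; the other half absorbs the error term of [ell_moment_lower]. *)
set (d := ln 2 - 2 / 3).
assert (Hd : 0 < d <= 1 / 3).
{ pose proof two_thirds_lt_ln_2. pose proof (exp_ineq1_le 1) as He.
  apply ln_le in He; [|lra]. rewrite ln_exp in He.
  replace (1 + 1) with 2 in He by ring. unfold d; lra. }
(* [v] is the square root of [1 - x]. Its size gives [a <= x], [2 * v <= d] for that error term, and
   [4 * C * v < d] for the final contradiction. *)
set (v := Rmin (1 - a) (d / (4 * C + 2))).
assert (Hk : d / (4 * C + 2) * (4 * C + 2) = d) by (field; lra).
assert (Hk0 : 0 < d / (4 * C + 2)) by (apply Rdiv_lt_0_compat; lra).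
assert (Hv0 : 0 < v) by (apply Rmin_glb_lt; lra).
assert (Hva : v <= 1 - a) by apply Rmin_l.
assert (Hvd : v <= d / (4 * C + 2)) by apply Rmin_r.
assert (Hvk : v * (4 * C + 2) <= d) by (rewrite <- Hk; apply Rmult_le_compat_r; lra).
assert (Hv2 : 2 * v <= d) by nra.
set (x := 1 - v ^ 2).
assert (Hx : a <= x < 1 /\ / 2 <= x) by (unfold x; nra).
assert (Hux : 1 - x = v ^ 2) by (unfold x; ring).
pose proof (log_denom_ge x ltac:(lra)) as HL.
assert (HLx : v * L x <= 2).
{ unfold log_denom. rewrite Hux, ln_pow by exact Hv0. simpl INR.
  pose proof (exp_ineq1_le (- ln v)) as He.
  rewrite exp_Ropp, exp_ln in He by exact Hv0.
  apply Rmult_le_compat_l with (r := v) in He; [|lra].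
  rewrite Rinv_r in He by lra. lra. }
assert (Hlow : L x + d <= ell_moment 0 x).
{ pose proof (ell_moment_lower x ltac:(lra)) as H.
  rewrite Hux, sqrt_pow2 in H by lra. pose proof PI_4.
  unfold log_denom. rewrite Hux. unfold d in *. nra. }
(* [b] is chosen below with [L b = 4 / 3 + T]. The factor 12 makes the excess [6 / L b] at most
   [d / (2 * L x)], and [L x <= T] puts [b] to the right of [x]. *)
set (T := L x * (1 + 12 / d)).
assert (HT : L x <= T /\ 12 * L x <= d * T).
{ assert (0 < 12 / d) by (apply Rdiv_lt_0_compat; lra). split; [unfold T; nra|].
  replace (d * T) with (L x * (d + 12)) by (unfold T; field; lra). nra. }
set (b := 1 - exp (- (2 * T))).
assert (Hub : 1 - b = exp (- (2 * T))) by (unfold b; ring).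
pose proof (exp_pos (- (2 * T))).
assert (Hxb : x < b).
{ assert (exp (- (2 * T)) < 1 - x); [|lra].
  rewrite <- (exp_ln (1 - x)) by lra. apply exp_increasing.
  unfold log_denom in HT at 1. lra. }
assert (HLb : L b = 4 / 3 + T).
{ unfold log_denom. rewrite Hub, ln_exp. field. }
pose proof (ell_moment_upper b ltac:(lra)) as Hup.
assert (Hup' : ell_moment 0 b <= L b + 6) by (unfold log_denom; lra).
specialize (HQ x b ltac:(lra) Hxb ltac:(lra)).
assert (H1 : 1 + d / L x <= quot (4 / 3) x).
{ unfold quot. apply Rmult_le_reg_r with (L x); [lra|].
  replace ((1 + d / L x) * L x) with (L x + d) by (field; lra).
  replace (ell_moment 0 x / L x * L x) with (ell_moment 0 x) by (field; lra).
  exact Hlow. }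
assert (H2 : quot (4 / 3) b <= 1 + d / (2 * L x)).
{ unfold quot. apply Rmult_le_reg_r with (L b); [lra|].
  replace (ell_moment 0 b / L b * L b) with (ell_moment 0 b) by (field; lra).
  apply Rle_trans with (1 := Hup'). rewrite Rmult_plus_distr_r, Rmult_1_l.
  apply Rplus_le_compat_l. apply Rmult_le_reg_r with (2 * L x); [lra|].
  replace (d / (2 * L x) * L b * (2 * L x)) with (d * L b) by (field; lra).
  rewrite HLb. lra. }
assert (H3 : d / L x <= d / (2 * L x) + C * v ^ 2) by (rewrite Hux in HQ; lra).
apply Rmult_le_compat_r with (r := 2 * L x) in H3; [|lra].
replace (d / L x * (2 * L x)) with (2 * d) in H3 by (field; lra).
replace ((d / (2 * L x) + C * v ^ 2) * (2 * L x))
  with (d + 2 * (C * v) * (v * L x)) in H3 by (field; lra).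
(* Now [d <= 4 * C * v], against the choice of [v]. *)
assert (C * v * (v * L x) <= C * v * 2) by (apply Rmult_le_compat_l; nra).
nra.
Qed.

Lemma scaled_derive2_neg_of_drift_neg (x : R) : 0 < x < 1 -> drift x < 0 -> scaled_derive2 x < 0.
Proof.
intros Hx HM. apply Rnot_le_lt; intros HW.
assert (Hpos : forall y, x <= y < 1 -> 0 <= scaled_derive2 y).
{ intros y Hy. apply Rle_trans with (1 := HW).
  apply nonneg_at_right_end with scaled_derive2'; [lra | intros; apply is_derive_scaled_derive2; lra | | exact HW].
  intros z Hz Hwz. pose proof (scaled_derive2_derive_sign z ltac:(lra) Hwz).
  assert (drift z < 0).
  { destruct (Req_dec z x) as [-> | Hne]; [exact HM|].
    pose proof (drift_decreasing x z); lra. }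
  nra. }
assert (HQ2 : forall y, x <= y < 1 -> 0 <= quot'' (4 / 3) y).
{ intros y Hy. pose proof (log_denom_ge y ltac:(lra)).
  apply Rmult_le_reg_l with (y * (1 - y) * L y).
  - repeat apply Rmult_lt_0_compat; lra.
  - rewrite quot_ode, Rmult_0_r by lra. apply Hpos, Hy. }
(* Q' is nondecreasing on [x, 1), so [- C] bounds it below there; the absolute value keeps [C]
   nonnegative. *)
set (C := Rabs (quot' (4 / 3) x)).
assert (HC : 0 <= C) by apply Rabs_pos.
assert (HQ1 : forall y, x <= y < 1 -> - C <= quot' (4 / 3) y).
{ intros y Hy. apply Rle_trans with (quot' (4 / 3) x).
  - unfold C. pose proof (Rle_abs (- quot' (4 / 3) x)). rewrite Rabs_Ropp in *. lra.
  - destruct (Req_dec x y) as [<- | Hne]; [lra|].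
    destruct (MVT_cor2 (quot' (4 / 3)) (quot'' (4 / 3)) x y ltac:(lra)) as [c [E Hc]].
    + intros c Hc. pose proof (log_denom_ge c ltac:(lra)).
      apply is_derive_Reals, is_derive_quot'; lra.
    + pose proof (HQ2 c ltac:(lra)). nra. }
assert (HQ : forall y b, x <= y -> y < b -> b < 1 ->
  quot (4 / 3) y <= quot (4 / 3) b + C * (1 - y)).
{ intros y b Hy Hyb Hb.
  destruct (MVT_cor2 (quot (4 / 3)) (quot' (4 / 3)) y b ltac:(lra)) as [c [E Hc]].
  - intros c Hc. pose proof (log_denom_ge c ltac:(lra)).
    apply is_derive_Reals, is_derive_quot; lra.
  - pose proof (HQ1 c ltac:(lra)). nra. }
apply (quot_not_lipschitz_at_1 C x); [exact HC | lra | exact HQ].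
Qed.

Theorem theorem1 (c : R) (hc : 1 <= c) :
  strictly_concave_on 0 1 (Q1 c) <-> c = exp (4 / 3).
Proof.
split.
- intros H.
  assert (Hl : 0 <= ln c) by (rewrite <- ln_1; apply ln_le; lra).
  destruct (Req_dec (ln c) (4 / 3)) as [<- | Hne]; [rewrite exp_ln; lra|].
  exfalso. apply (quot_not_concave (ln c) Hl Hne).
  apply strictly_concave_ext with (2 := H). intros; apply Q1_quot; lra.
- intros ->.
  apply strictly_concave_ext with (quot (4 / 3)).
  { intros x Hx. rewrite Q1_quot, ln_exp; lra. }
  assert (HL : forall x, 0 < x < 1 -> 4 / 3 <= L x)
    by (intros; apply log_denom_ge; lra).
  apply strictly_concave_of_derive2_neg with (quot' (4 / 3)) (quot'' (4 / 3)).
  + intros x Hx. specialize (HL x Hx). apply is_derive_quot; lra.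
  + intros x Hx. specialize (HL x Hx). apply is_derive_quot'; lra.
  + intros x Hx. specialize (HL x Hx).
    assert (Hw : scaled_derive2 x < 0).
    { destruct (Rtotal_order (drift x) 0) as [HM | [HM | HM]].
      - apply scaled_derive2_neg_of_drift_neg; assumption.
      - apply scaled_derive2_neg_of_drift_0; assumption.
      - apply scaled_derive2_neg_of_drift_pos; assumption. }
    rewrite <- quot_ode in Hw by lra.
    apply Rnot_le_lt; intros H.
    apply (Rlt_not_le _ _ Hw), Rmult_le_pos; [|exact H].
    repeat apply Rmult_le_pos; lra.
Qed.
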